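(* Let $(r_k)_{k\ge1}$ be a sequence of pairwise distinct positive real numbers and let $f\colon[0,\infty)\to\mathbb{R}$ be a real analytic function (analytic on $[0,\infty)$, including at $0$) such that the set $$U=\{u>0 : (f(r_ku))_{k\ge1}\in\mathcal{G}\}$$ is uncountable. Then $f$ is a polynomial.
   Context: A sequence of real numbers $(a_k)_{k\ge1}$ is called pointwise good (written $(a_k)\in\mathcal{G}$) if for every measure preserving flow $(U_t)_{t\in\mathbb{R}}$ on a probability space $(X,\mathcal{B},\mu)$ (a measurable action of $\mathbb{R}$ by measure preserving transformations) and every $F\in L^\infty(X,\mu)$, the averages $\frac1n\sum_{k=1}^n F(U_{a_k}x)$ converge for $\mu$-almost every $x$ as $n\to\infty$. *)

(* Defs.v *)
From HB Require Import structures.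
From mathcomp Require Import all_boot all_order all_algebra.
From mathcomp Require Import all_classical all_reals all_analysis.
Set Implicit Arguments. Unset Strict Implicit. Unset Printing Implicit Defensive.
Import Order.TTheory GRing.Theory Num.Theory.
Import numFieldTopology.Exports numFieldNormedType.Exports.
Local Open Scope classical_set_scope.
Local Open Scope ring_scope.

Definition measure_preserving_flow (R : realType) (d : measure_display)
  (T : measurableType d) (P : probability T R) (U : R -> T -> T) : Prop :=
  [/\ (forall x, U 0 x = x),
      (forall s t x, U (s + t) x = U s (U t x)),
      measurable_fun [set: R * T] (fun p : R * T => U p.1 p.2),
      (forall t, measurable_fun [set: T] (U t)) &
      (forall t (A : set T), measurable A -> P (U t @^-1` A) = P A)].

Definition Linfty (R : realType) (d : measure_display)
  (T : measurableType d) (P : probability T R) (F : T -> R) : Prop :=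
  measurable_fun [set: T] F /\ exists M : R, {ae P, forall x, `|F x| <= M}.

(* Ergodic averages (1/n) sum_{k=1}^n F(U_{a_k} x), indexed so that
   entry n of the sequence is the average of the first n+1 terms. *)
Definition ergavg (R : realType) (T : Type) (U : R -> T -> T) (a : nat -> R)
  (F : T -> R) (x : T) : R^nat :=
  fun n => n.+1%:R^-1 * \sum_(k < n.+1) F (U (a k) x).

Definition pointwise_good (R : realType) (a : nat -> R) : Prop :=
  forall (d : measure_display) (T : measurableType d) (P : probability T R)
         (U : R -> T -> T) (F : T -> R),
    measure_preserving_flow P U -> Linfty P F ->
    {ae P, forall x, cvgn (ergavg U a F x)}.

Definition analytic_on_nonneg (R : realType) (f : R -> R) : Prop :=
  forall x0 : R, 0 <= x0 ->
    exists (c : nat -> R) (delta : R), 0 < delta /\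
      forall x, 0 <= x -> `|x - x0| < delta ->
        (series (fun k => c k * (x - x0) ^+ k)) @ \oo --> f x.

(* Main.v *)
Require Import Defs.
From HB Require Import structures.
From mathcomp Require Import all_boot all_order all_algebra.
From mathcomp Require Import all_classical all_reals all_analysis.
From mathcomp Require Import measurable_realfun ring lra zify.
Set Implicit Arguments. Unset Strict Implicit. Unset Printing Implicit Defensive.
Import Order.TTheory GRing.Theory Num.Theory.
Import numFieldTopology.Exports numFieldNormedType.Exports.
Local Open Scope classical_set_scope.
Local Open Scope ring_scope.

(** If f is not a polynomial, infinitely many Taylor coefficients c_n of f at 0
    are nonzero.  For integers q_1, ..., q_K, not all zero, the Taylor
    coefficients at 0 of u |-> sum_k q_k f(r_k u) are c_n sum_k q_k r_k^n, and the
    second factor is nonzero for large n because the largest r_k with q_k <> 0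
    dominates.  So this function has countably many zeros, and for all but
    countably many u the numbers f(r_k u) are linearly independent over Q.

    A sequence a that is linearly independent over Q is not pointwise good.  Pick l
    such that 1 and the l a_k are independent, and let R act on the circle by
    rotation at speed l.  By Kronecker's theorem there is an integer m such that
    m l a_k is close to -i/L mod 1 for 2^i <= k < 2^(i+1) and i in a window of length
    L.  Then for every x some i in the window puts the points m (x + l a_k) of the
    i-th block near 0 mod 1, so that some late average at x of the indicator of
    {y : m y is near an integer} is at least 1/2, although this set has measure
    O(1/L).  The union of such sets over all scales has measure at most 1/4, and its
    averages are at least 1/2 infinitely often at every point, so by Fatou's lemma
    they do not converge almost everywhere. *)

(** * Kronecker's theorem *)

(** Pigeonhole: the fractional parts of [N ^ K + 1] multiples of [v] fall into [N ^ K] boxes of side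
    [1 / N < e]. The difference of two indices that share a box serves as [m]. *)
Lemma dirichlet_simultaneous (R : archiRealFieldType) (K : nat) (v : nat -> R) (e : R) :
  0 < e -> exists (m : nat) (p : nat -> int),
    (0 < m)%N /\ forall k, (k < K)%N -> `|m%:R * v k - (p k)%:~R| < e.
Proof.
move=> e0; pose N := (Num.trunc e^-1).+1.
have N0 : 0 < N%:R :> R by rewrite ltr0n.
have Ne : N%:R^-1 < e.
  by rewrite -[ltRHS]invrK ltf_pV2 ?posrE ?invr_gt0// truncnS_gt.
pose fr (x : R) : R := x - (Num.floor x)%:~R.
have fr0 x : 0 <= fr x by rewrite subr_ge0 floor_le.
have fr1 x : fr x < 1 by have := floorD1_gt x; rewrite /fr intrD; lra.
have box x : (Num.trunc (N%:R * fr x)%R < N)%N.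
  by rewrite truncn_lt_nat ?mulr_ge0 ?(ltW N0)// gtr_pMr.
pose g (i : 'I_(N ^ K).+1) : {ffun 'I_K -> 'I_N} :=
  [ffun k : 'I_K => Ordinal (box ((i : nat)%:R * v k))].
have /injectivePn[i [j ij gij]] : ~~ injectiveb g.
  apply/negP => /injectiveP /leq_card.
  by rewrite card_ffun !card_ord ltnn.
wlog ltij : i j ij gij / (i < j)%N.
  move=> H; case: (ltngtP i j) => [lt|lt|eq].
  - exact: (H i j).
  - by apply: (H j i) => //; rewrite eq_sym.
  - by case/eqP: ij; apply: val_inj.
exists (j - i)%N, (fun k => Num.floor (j%:R * v k) - Num.floor (i%:R * v k)).
split=> [|k kK]; first by rewrite subn_gt0.
have /ffunP/(_ (Ordinal kK)) := gij; rewrite !ffunE => /(congr1 val)/= tE.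
have tru x : (Num.trunc (N%:R * fr x))%:R <= N%:R * fr x < (Num.trunc (N%:R * fr x))%:R + 1.
  by rewrite natr1 truncn_itv// mulr_ge0// ltW.
have /andP[a1 a2] := tru (i%:R * v k); have /andP[b1 b2] := tru (j%:R * v k).
rewrite tE in a1 a2.
have -> : (j - i)%:R * v k - (Num.floor (j%:R * v k) - Num.floor (i%:R * v k))%:~R
    = fr (j%:R * v k) - fr (i%:R * v k).
  by rewrite natrB ?(ltnW ltij)// intrB /fr; ring.
apply: lt_trans Ne; rewrite -[ltRHS]mul1r ltr_pdivlMr//.
rewrite -[X in _ * X]gtr0_norm// -normrM ltr_norml; apply/andP; split; lra.
Qed.

Section Kronecker.
Variable R : archiRealFieldType.

(** Integer times need independence of the [v k] together with 1, real times only of the [v k]. The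
    two forms are proved in alternation: integer times for [K] give real times for [K.+1], which
    give integer times for [K.+1]. *)
Definition kronecker_int (K : nat) := forall v : nat -> R,
  (forall (q : nat -> int) (q0 : int),
     \sum_(k < K) (q k)%:~R * v k + q0%:~R = 0 -> forall k, (k < K)%N -> q k = 0) ->
  forall (theta : nat -> R) (e : R), 0 < e ->
  exists (m : int) (p : nat -> int), forall k, (k < K)%N ->
    `|m%:~R * v k - theta k - (p k)%:~R| < e.

Definition kronecker_real (K : nat) := forall v : nat -> R,
  (forall q : nat -> int,
     \sum_(k < K) (q k)%:~R * v k = 0 -> forall k, (k < K)%N -> q k = 0) ->
  forall (theta : nat -> R) (e : R), 0 < e ->
  exists (t : R) (p : nat -> int), forall k, (k < K)%N ->
    `|t * v k - theta k - (p k)%:~R| < e.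

(* The time t is chosen among those at which the last coordinate hits its target exactly. *)
Lemma kronecker_realS K : kronecker_int K -> kronecker_real K.+1.
Proof.
move=> IH v indep theta e e0.
have vK0 : v K != 0.
  apply/eqP => vK0.
  have : (fun k => (k == K)%:Z) K = 0.
    apply: (indep (fun k => (k == K)%:Z)) => //.
    rewrite big_ord_recr/= vK0 mulr0 addr0 big1// => i _.
    by rewrite (ltn_eqF (ltn_ord i)) mul0r.
  by rewrite eqxx.
(* If [t * v K = m + theta K], then [t * v k] is [m * (v k / v K)] plus a fixed shift, which is
   moved into the target. The ratios and 1 are independent because the [v k] are. *)
have [|m [p Hp]] := IH (fun k => v k / v K) _ (fun k => theta k - theta K * (v k / v K)) e e0.
  move=> q q0 q0E k kK.
  pose q' k := if (k < K)%N then q k else q0.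
  have : q' k = 0; last by rewrite /q' kK.
  apply: indep (ltnW kK); rewrite big_ord_recr/= {2}/q' ltnn.
  transitivity ((\sum_(k < K) (q k)%:~R * (v k / v K) + q0%:~R) * v K); last by rewrite q0E mul0r.
  rewrite mulrDl mulr_suml; congr +%R.
  by apply: eq_bigr => i _; rewrite /q' ltn_ord -mulrA divfK.
exists ((m%:~R + theta K) / v K), (fun k => if (k < K)%N then p k else m).
move=> k; rewrite ltnS leq_eqVlt => /predU1P[->|kK].
  by rewrite ltnn divfK// addrK subrr normr0.
rewrite kK; apply: le_lt_trans (Hp k kK); rewrite le_eqVlt; apply/orP; left; apply/eqP.
by congr `|_|; field.
Qed.

(* A multiple of v that is small mod 1 turns real times into integer times up to a small error. *)
Lemma kronecker_int_of_real K : kronecker_real K -> kronecker_int K.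
Proof.
move=> HK v indep theta e e0.
have e20 : 0 < e / 2 by rewrite divr_gt0.
have [m [p [m0 Hp]]] := @dirichlet_simultaneous R K v _ e20.
have [|t [p' Hp']] := HK (fun k => m%:R * v k - (p k)%:~R) _ theta _ e20.
  move=> q qE k kK.
  have : q k * m%:Z = 0.
    apply: (indep (fun k => q k * m%:Z) (- \sum_(k < K) q k * p k)) => //.
    rewrite -[RHS]qE mulrNz rmorph_sum/= -sumrB. apply: eq_bigr => i _.
    by rewrite !intrM; ring.
  by move/eqP; rewrite mulf_eq0 => /orP[/eqP//|]; case: m m0 {Hp qE} => //.
exists (Num.floor t * m%:Z), (fun k => p' k + Num.floor t * p k) => k kK.
have := Hp' k kK; have := Hp k kK.
set u := _ - (p k)%:~R => Hu Ht.
have -> : (Num.floor t * m)%:~R * v k - theta k - (p' k + Num.floor t * p k)%:~R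
   = (t * u - theta k - (p' k)%:~R) - (t - (Num.floor t)%:~R) * u.
  by rewrite /u !(intrM, intrD); ring.
rewrite (splitr e); apply: le_lt_trans (ler_normB _ _) _; apply: ltrD => //.
apply: le_lt_trans Hu; rewrite normrM ler_piMl// ger0_norm ?subr_ge0 ?floor_le//.
by have := floorD1_gt t; rewrite intrD; lra.
Qed.

Lemma kronecker K : kronecker_int K.
Proof.
apply: kronecker_int_of_real; elim: K => [v _ theta e _|K IH].
  by exists 0, (fun=> 0).
exact/kronecker_realS/kronecker_int_of_real.
Qed.

End Kronecker.

(** * Rotations of the circle *)

Section RotationFlow.
Variable R : realType.
Notation mu := (@lebesgue_measure R).

(** The pushforward under a translation agrees with [mu] on half-open intervals, which determine the
    measure. *)
Lemma lebesgue_measure_translate (s : R) (A : set (measurableTypeR R)) : measurable A ->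
  mu ((fun x => x + s) @^-1` A) = mu A.
Proof.
have mf : measurable_fun setT ((fun x => x + s) : measurableTypeR R -> measurableTypeR R).
  exact: measurable_funD.
move=> mA; rewrite -[LHS]/(pushforward mu ((fun x => x + s) : _ -> measurableTypeR R) A).
apply/esym/lebesgue_measure_unique => //= _ [[a b]] _ <-.
rewrite /pushforward.
have -> : (fun x : R => x + s) @^-1` `]a, b]%classic = `](a - s), (b - s)]%classic.
  by apply/seteqP; split => x /=; rewrite !in_itv/= ltrBlDr lerBrDr.
by rewrite !lebesgue_measure_itv/= !lte_fin ltrD2r -!EFinD opprB addrA subrK.
Qed.

Definition unit_prob : set (measurableTypeR R) -> \bar R :=
  mrestr mu (measurable_itv `[0 : R, 1[).

HB.instance Definition _ := Measure.on unit_prob.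

Lemma unit_probT : unit_prob setT = 1%E.
Proof.
by rewrite /unit_prob /mrestr setTI lebesgue_measure_itv/= lte_fin ltr01 oppr0 adde0.
Qed.

HB.instance Definition _ := Measure_isProbability.Build _ _ R unit_prob unit_probT.

(* The circle is the unit interval; to get a flow on the whole carrier, each interval
   [n, n+1[ is rotated separately. *)
Definition rotation_flow (l t : R) (x : measurableTypeR R) : measurableTypeR R :=
  x + l * t - (Num.floor (x + l * t))%:~R + (Num.floor x)%:~R.

Lemma rotation_flowE l t x : exists z : int, rotation_flow l t x = x + l * t + z%:~R.
Proof.
exists (Num.floor x - Num.floor (x + l * t)).
by rewrite intrB /rotation_flow; ring.
Qed.

Lemma floor_rotation_flow l t x : Num.floor (rotation_flow l t x) = Num.floor x.
Proof.
apply: floor_def; rewrite /rotation_flow.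
have := floor_le (x + l * t); have := floorD1_gt (x + l * t).
by rewrite !intrD; lra.
Qed.

(** Points congruent mod 1 with the same floor are equal; this identifies values of the flow without
    computing floors of sums. *)
Lemma rotation_flow_id l t x y (z : int) :
  Num.floor y = Num.floor x -> y = x + l * t + z%:~R -> rotation_flow l t x = y.
Proof.
move=> fyx yE; have [z' z'E] := rotation_flowE l t x.
have yE' : y = rotation_flow l t x + (z - z')%:~R by rewrite yE z'E intrB; ring.
have := floorDrz (rotation_flow l t x) (intr_int R (z - z')).
rewrite -yE' fyx floor_rotation_flow intrKfloor => zz'.
have {}zz' : z - z' = 0 by lia.
by rewrite yE' zz' addr0.
Qed.

Lemma measurable_fun_floor : measurable_fun setT (fun x : R => (Num.floor x)%:~R : R).
Proof. by apply: nondecreasing_measurable => // x y xy; rewrite ler_int le_floor. Qed.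

Lemma measurable_rotation_flow2 l :
  measurable_fun setT (fun p : R * measurableTypeR R => rotation_flow l p.1 p.2).
Proof.
have m1 : measurable_fun setT (fun p : R * measurableTypeR R => p.2 + l * p.1 : R).
  apply: measurable_funD; first exact: measurable_snd.
  by apply: measurable_funM => //; exact: measurable_fst.
apply: measurable_funD.
  apply: measurable_funB => //.
  exact: (measurableT_comp measurable_fun_floor m1).
by apply: (measurableT_comp measurable_fun_floor); exact: measurable_snd.
Qed.

Lemma measurable_rotation_flow l t :
  measurable_fun setT (rotation_flow l t).
Proof.
have m1 : measurable_fun setT (fun x : measurableTypeR R => x + l * t : R).
  exact: measurable_funD.
apply: measurable_funD.
  by apply: measurable_funB => //; exact: (measurableT_comp measurable_fun_floor m1).
exact: measurable_fun_floor.
Qed.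

(** On [[0, 1[] the rotation exchanges two intervals: [[0, 1 - s[] moves by [s] and [[1 - s, 1[] by
    [s - 1]. Translation invariance applies to each piece. *)
Lemma unit_prob_rotation l t (A : set (measurableTypeR R)) : measurable A ->
  unit_prob (rotation_flow l t @^-1` A) = unit_prob A.
Proof.
move=> mA.
pose s := l * t - (Num.floor (l * t))%:~R.
have s0 : 0 <= s by rewrite subr_ge0 floor_le.
have s1 : s < 1 by have := floorD1_gt (l * t); rewrite intrD /s; lra.
have flowl x : 0 <= x -> x < 1 - s -> rotation_flow l t x = x + s.
  move=> x0 x1; apply: (@rotation_flow_id _ _ _ _ (- Num.floor (l * t))).
    by rewrite (@floor_def _ _ 0) ?(@floor_def _ x 0)//; apply/andP; split; lra.
  by rewrite /s intrN; ring.
have flowr x : 1 - s <= x -> x < 1 -> rotation_flow l t x = x + (s - 1).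
  move=> x0 x1; apply: (@rotation_flow_id _ _ _ _ (- Num.floor (l * t) - 1)).
    by rewrite (@floor_def _ _ 0) ?(@floor_def _ x 0)//; apply/andP; split; lra.
  by rewrite /s intrD intrN; ring.
pose B1 := A `&` `[s, 1[%classic; pose B2 := A `&` `[0, s[%classic.
have mB1 : measurable B1 by exact: measurableI.
have mB2 : measurable B2 by exact: measurableI.
have -> : unit_prob A = (mu B1 + mu B2)%E.
  rewrite -measureU//.
    rewrite /unit_prob /mrestr -setIUr; congr (mu (_ `&` _)).
    apply/seteqP; split=> x /=; rewrite !in_itv/=.
      by case: (leP s x) => sx /andP[x0 x1]; [left|right]; rewrite ?x0 ?x1.
    by case=> /andP[x0 x1]; apply/andP; split; lra.
  apply/seteqP; split=> // x [[_ /=]]; rewrite in_itv/= => /andP[sx _] [_ /=].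
  by rewrite in_itv/= ltNge sx andbF.
have mt c : measurable_fun setT ((fun x => x + c) : measurableTypeR R -> measurableTypeR R).
  exact: measurable_funD.
rewrite -(lebesgue_measure_translate s mB1) -(lebesgue_measure_translate (s - 1) mB2).
rewrite -measureU//.
- rewrite /unit_prob /mrestr; congr (mu _); apply/seteqP; split=> x /=.
    move=> [Ax]; rewrite in_itv/= => /andP[x0 x1].
    case: (ltP x (1 - s)) => xs; [left|right]; split; rewrite /= ?in_itv/=.
    + by rewrite -flowl.
    + by apply/andP; split; lra.
    + by rewrite -flowr.
    + by apply/andP; split; lra.
  case=> -[Ax]; rewrite /= !in_itv/= => /andP[x0 x1]; split.
  + by rewrite flowl//; lra.
  + by apply/andP; split; lra.
  + by rewrite flowr//; lra.
  + by apply/andP; split; lra.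
- by rewrite -[X in measurable X]setTI; exact: mt.
- by rewrite -[X in measurable X]setTI; exact: mt.
apply/seteqP; split=> // x [[_ /=]]; rewrite in_itv/= => /andP[sx sx1] [_ /=].
by rewrite in_itv/= => /andP[? ?]; lra.
Qed.

Lemma rotation_flow_mp l : measure_preserving_flow unit_prob (rotation_flow l).
Proof.
split.
- by move=> x; rewrite /rotation_flow mulr0 addr0 subrK.
- move=> s t x; have [z1 z1E] := rotation_flowE l t x.
  have [z2 z2E] := rotation_flowE l s (rotation_flow l t x).
  apply: (@rotation_flow_id _ _ _ _ (z1 + z2)); first by rewrite !floor_rotation_flow.
  by rewrite z2E z1E intrD; ring.
- exact: measurable_rotation_flow2.
- exact: measurable_rotation_flow.
- by move=> t A mA; exact: unit_prob_rotation.
Qed.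

End RotationFlow.

(** * Divergence along independent sequences *)

(** For [q > 0] and [d <= 1/2] this set has density [2 * d] whatever [q] is, so [q] can be adapted
    to the sequence at no cost in measure. *)
Definition near_int_set (R : realType) (q : nat) (d : R) : set R :=
  [set x | exists p : int, `|q%:R * x - p%:~R| < d].

Lemma near_int_setD_int (R : realType) q (d x : R) (z : int) :
  near_int_set q d (x + z%:~R) <-> near_int_set q d x.
Proof.
split=> -[p Hp]; [exists (p - q%:Z * z)|exists (p + q%:Z * z)]; apply: le_lt_trans Hp;
  rewrite le_eqVlt; apply/orP; left; apply/eqP; congr `|_|;
  rewrite ?intrB ?intrD intrM; ring.
Qed.

(** If [m * x] lies in [[i/L, (i+1)/L[] mod 1 and [m * v k] is within [1/L] of [-i/L] mod 1, then
    [m * (x + v k)] is within [2/L < d] of an integer. The [L] blocks of the window serve all [L]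
    positions of [m * x]. *)
Lemma sweeping (R : realType) (v : nat -> R) :
  (forall (K : nat) (q : nat -> int) (q0 : int),
     \sum_(k < K) (q k)%:~R * v k + q0%:~R = 0 -> forall k, (k < K)%N -> q k = 0) ->
  forall (d : R) (j : nat), 0 < d ->
  exists q : nat, (0 < q)%N /\ forall x, exists n, (j <= n)%N /\
    2^-1 <= n.+1%:R^-1 * \sum_(k < n.+1) \1_(near_int_set q d) (x + v k) :> R.
Proof.
move=> indep d j d0.
pose L := (Num.trunc (2 / d)).+2.
have L0 : 0 < L%:R :> R by rewrite ltr0n.
have Ld : 2 / L%:R < d.
  rewrite ltr_pdivrMr// mulrC -ltr_pdivrMr//.
  by apply: (lt_trans (truncnS_gt _)); rewrite ltr_nat.
have L2 : 2 <= L%:R :> R by rewrite ler_nat.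
have iL0 : 0 < L%:R^-1 :> R by rewrite invr_gt0.
pose theta k : R := - ((trunc_log 2 k)%:R / L%:R).
have [m [p Hmp]] := @kronecker R (2 ^ (j + L.+1)) v (indep _) theta _ iL0.
(* The index 2 lies in block 1, with target [-1/L]. For [m = 0] the integer [p 2] would lie strictly
   between 0 and [2/L <= 1]. *)
have m0 : m != 0.
  apply/eqP => m0; have K2 : (2 < 2 ^ (j + L.+1))%N.
    by rewrite (@leq_trans (2 ^ 2))// leq_exp2l// !addnS.
  have := Hmp _ K2; rewrite m0 mul0r sub0r /theta opprK.
  have -> : trunc_log 2 2 = 1%N by [].
  have iL1 : L%:R^-1 <= 2^-1 :> R by rewrite lef_pV2 ?posrE.
  rewrite mul1r ltr_norml => /andP[h1 h2].
  have p0 : 0 < (p 2%N)%:~R :> R by lra.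
  have p1 : (p 2%N)%:~R < 1 :> R by lra.
  by move: p0 p1; rewrite ltr0z ltrz1; lia.
exists `|m|%N; split; first by rewrite absz_gt0.
(* Kronecker's theorem may give a negative [m]; being near an integer is insensitive to the sign. *)
have nearm y : (exists z : int, `|m%:~R * y - z%:~R| < d) -> near_int_set `|m|%N d y.
  move=> [z Hz]; case: (leP 0 m) => [m_ge0|m_lt0].
    by exists z; rewrite pmulrn gez0_abs.
  exists (- z); rewrite pmulrn ltz0_abs// -normrN; apply: le_lt_trans Hz.
  by rewrite le_eqVlt; apply/orP; left; apply/eqP; congr `|_|; rewrite !intrN; ring.
move=> x.
(* [s] is the position of [m * x] in units of [1/L], and [i] is its representative modulo [L] in the
   window from [j] to [j + L - 1]. *)
pose s := Num.floor (L%:R * (m%:~R * x)).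
pose i := (j + `|((s - j%:Z) %% L%:Z)%Z|)%N.
pose z := ((s - j%:Z) %/ L%:Z)%Z.
have Lz0 : L%:Z != 0 by [].
have sE : s = i%:Z + L%:Z * z.
  rewrite /i PoszD gez0_abs ?modz_ge0//.
  have := divz_eq (s - j%:Z) L%:Z; rewrite -/z mulrC; lia.
have iL : (i < j + L)%N.
  by rewrite ltn_add2l -ltz_nat gez0_abs ?modz_ge0// ltz_pmod.
have hit k : (2 ^ i <= k < 2 ^ i.+1)%N -> \1_(near_int_set `|m|%N d) (x + v k) = 1 :> R.
  move=> /andP[k1 k2]; rewrite indicE mem_set//; apply: nearm.
  exists (z + p k); have kK : (k < 2 ^ (j + L.+1))%N.
    by apply: (leq_trans k2); rewrite leq_exp2l// addnS ltnW.
  have := Hmp _ kK; rewrite /theta (@trunc_log_eq _ i) ?k1// opprK => Hk.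
  have s1 := floor_le (L%:R * (m%:~R * x)).
  have s2 := floorD1_gt (L%:R * (m%:~R * x)).
  rewrite -/s intrD sE intrD intrM -!pmulrn in s1 s2.
  have LE : L%:R * (m%:~R * x - (i%:R / L%:R + z%:~R)) =
      L%:R * (m%:~R * x) - (i%:R + L%:R * z%:~R) by field; rewrite gt_eqF.
  have t1 : 0 <= m%:~R * x - (i%:R / L%:R + z%:~R).
    by rewrite -(pmulr_rge0 _ L0) LE; lra.
  have t2 : m%:~R * x - (i%:R / L%:R + z%:~R) < L%:R^-1.
    by rewrite -(ltr_pM2l L0) LE divff ?gt_eqF//; lra.
  move: Hk; rewrite !ltr_norml => /andP[Hk1 Hk2].
  rewrite intrD mulrDr.
  by apply/andP; split; lra.
(* Entry [n] averages [n.+1 = 2 ^ i.+1] terms; block [i] is the second half of them and contributes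
   1 each time. *)
exists (2 ^ i.+1).-1; rewrite prednK ?expn_gt0//; split.
  rewrite -ltnS prednK ?expn_gt0//; apply: leq_trans (ltn_expl _ _) => //.
  by rewrite ltnS (leq_trans (leq_addr _ _) (leqnSn _)).
rewrite -(big_mkord xpredT (fun k => \1_(near_int_set `|m|%N d) (x + v k))).
rewrite (@big_cat_nat _ _ _ (2 ^ i))//=; last by rewrite leq_exp2l.
rewrite [X in _ + X](eq_big_nat _ _ (F2 := fun=> 1)); last by move=> k /hit.
rewrite sumr_const_nat expnS mul2n -addnn addnK natrD.
have w0 : 0 < (2 ^ i)%:R :> R by rewrite ltr0n expn_gt0.
have t0 : 0 <= \sum_(0 <= k < 2 ^ i) \1_(near_int_set `|m|%N d) (x + v k) :> R.
  by apply: sumr_ge0 => k _; rewrite indicE.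
rewrite mulrC ler_pdivlMr ?addr_gt0//; lra.
Qed.

Lemma near_int_set_bigcup (R : realType) (q : nat) (d : R) : (0 < q)%N ->
  near_int_set q d = \bigcup_(p : int) `]((p%:~R - d) / q%:R), ((p%:~R + d) / q%:R)[%classic.
Proof.
move=> q0; have q0' : 0 < q%:R :> R by rewrite ltr0n.
apply/seteqP; split => x.
  move=> [p]; rewrite ltr_norml => /andP[h1 h2]; exists p => //=.
  rewrite in_itv/= ltr_pdivrMr// ltr_pdivlMr// mulrC; apply/andP; split; lra.
move=> [p _]/=; rewrite in_itv/= ltr_pdivrMr// ltr_pdivlMr// mulrC => /andP[h1 h2].
by exists p; rewrite ltr_norml; apply/andP; split; lra.
Qed.

Lemma measurable_near_int_set (R : realType) (q : nat) (d : R) : (0 < q)%N ->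
  measurable (near_int_set q d : set (measurableTypeR R)).
Proof.
move=> q0; rewrite near_int_set_bigcup//.
by apply: countable_bigcupT_measurable.
Qed.

(** As [d <= 1], only the intervals around [p / q] with [0 <= p <= q] can meet [[0, 1[]. Their total
    length is [2 * d * (q + 1) / q], at most [4 * d]. *)
Lemma unit_prob_near_int_set (R : realType) (q : nat) (d : R) : (0 < q)%N -> 0 < d <= 1 ->
  (unit_prob (near_int_set q d) <= (4 * d)%:E)%E.
Proof.
move=> q0 /andP[d0 d1]; have q0' : 0 < q%:R :> R by rewrite ltr0n.
have q1 : 1 <= q%:R :> R by rewrite ler1n.
pose I (p : nat) : set (measurableTypeR R) := `]((p%:R - d) / q%:R), ((p%:R + d) / q%:R)[%classic.
have mI p : (p < q.+1)%N -> measurable (I p) by move=> _; exact: measurable_itv.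
apply: (@le_trans _ _ (lebesgue_measure (\big[setU/set0]_(p < q.+1) I p))).
  apply: le_measure; rewrite ?inE.
  - by apply: measurableI => //; exact: measurable_near_int_set.
  - by apply: bigsetU_measurable => p _; exact: measurable_itv.
  - rewrite -bigcup_mkord => x [[p]]; rewrite ltr_norml => /andP[h1 h2]/=.
    rewrite in_itv/= => /andP[x0 x1].
    have qx0 : 0 <= q%:R * x by rewrite mulr_ge0// ltW.
    have qx1 : q%:R * x < q%:R by rewrite gtr_pMr.
    have p0 : -1 < p by rewrite -(ltr_int R); lra.
    have p1 : p < q.+1%:Z by rewrite -(ltr_int R) -addn1 PoszD intrD -!pmulrn; lra.
    case: p p0 p1 h1 h2 => // p _ p1 h1 h2; exists p => //.
    rewrite /I/= in_itv/= ltr_pdivrMr// ltr_pdivlMr// mulrC.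
    by apply/andP; split; lra.
apply: le_trans (Boole_inequality _ mI) _.
have muI p : lebesgue_measure (I p) = (2 * d / q%:R)%:E.
  rewrite /I lebesgue_measure_itv/= lte_fin ltr_pM2r ?invr_gt0//.
  rewrite ifT; last by lra.
  by rewrite -EFinD; congr EFin; field; rewrite gt_eqF.
rewrite (eq_bigr (fun=> (2 * d / q%:R)%:E)) => [|p _]; last exact: muI.
rewrite sumEFin sumr_const card_ord lee_fin -[X in X <= _]mulr_natr mulrAC.
rewrite ler_pdivrMr// -natr1; nra.
Qed.

(** A relation with [q0] and a nonzero sum [S] forces [l = - q0 / S], so only countably many speeds
    are bad. *)
Lemma exists_rotation_speed (R : realType) (a : nat -> R) :
  (forall (K : nat) (q : nat -> int),
     \sum_(k < K) (q k)%:~R * a k = 0 -> forall k, (k < K)%N -> q k = 0) ->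
  exists l : R, forall (K : nat) (q : nat -> int) (q0 : int),
     \sum_(k < K) (q k)%:~R * (l * a k) + q0%:~R = 0 -> forall k, (k < K)%N -> q k = 0.
Proof.
move=> indep.
(* When the sum vanishes, division by zero gives the value 0, which is harmless since [l != 0] is
   also required. *)
pose c (s : seq int * int) : R := - (s.2%:~R / \sum_(k < size s.1) (s.1`_k)%:~R * a k).
have cc : countable (range c) by exact: sub_countable (card_image_le _ _) (countableP _).
have [l [l0 lc]] : exists l, l != 0 /\ ~ range c l.
  apply: contrapT => H.
  have : countable (`[1, 2]%classic : set R).
    apply: (sub_countable _ cc); apply: subset_card_le => l; rewrite /= in_itv/= => /andP[l1 _].
    by apply: contrapT => ?; apply: H; exists l; split=> //; rewrite gt_eqF//; lra.
  move=> /countable_lebesgue_measure0 /eqP; rewrite lebesgue_measure_itv/= lte_fin.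
  by rewrite ifT; [rewrite -EFinB => /eqP[]|]; lra.
exists l => K q q0.
under eq_bigr do rewrite mulrCA.
rewrite -mulr_sumr; set S := \sum_(k < K) _ => SE.
case: (eqVneq S 0) => [S0|S0]; first exact: (indep K).
case: lc; exists ([seq q k | k <- iota 0 K], q0) => //.
rewrite /c/= size_map size_iota.
rewrite (eq_bigr (fun k : 'I_K => (q k)%:~R * a k)); last first.
  by move=> k _; rewrite (nth_map 0%N) ?size_iota// nth_iota.
by rewrite -/S; apply: (mulIf S0); rewrite mulNr divfK//; lra.
Qed.

(** * Averages of an indicator and Fatou's lemma *)

Section ErgodicAverages.
Variables (R : realType) (d : measure_display) (T : measurableType d).
Variables (P : probability T R) (U : R -> T -> T) (a : nat -> R).
Hypothesis PU : measure_preserving_flow P U.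
Variable (E : set T).
Hypothesis mE : measurable E.

Lemma ergavg_indic_ge0 n x : 0 <= ergavg U a \1_E x n.
Proof. by rewrite mulr_ge0 ?invr_ge0// sumr_ge0// => k _; rewrite indicE. Qed.

Lemma measurable_ergavg_indic n : measurable_fun setT (fun x => ergavg U a \1_E x n).
Proof.
have [_ _ _ mU _] := PU.
apply: measurable_funM => //; apply: measurable_sum => k.
by apply: measurableT_comp; [exact: measurable_indic|exact: mU].
Qed.

Lemma integral_ergavg_indic n : (\int[P]_x (ergavg U a \1_E x n)%:E = P E)%E.
Proof.
have [_ _ _ mU PUE] := PU.
have mUE k : measurable (U (a k) @^-1` E) by rewrite -[X in measurable X]setTI; exact: mU.
under eq_integral do rewrite /ergavg EFinM -sumEFin.
have mi (k : 'I_n.+1) : measurable_fun setT (fun x => (\1_E (U (a k) x))%:E : \bar R).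
  by apply/measurable_EFinP/measurableT_comp; [exact: measurable_indic|exact: mU].
rewrite ge0_integralZl_EFin ?invr_ge0//; last 2 first.
  by move=> x _; apply: sume_ge0 => k _; rewrite lee_fin indicE.
  exact: emeasurable_sum.
rewrite ge0_integral_sum//.
rewrite (eq_bigr (fun=> P E)); last first.
  move=> k _; rewrite -(PUE (a k)) // -[in RHS](setIT (U _ @^-1` _)) -integral_indic//.
have /fineK <- : P E \is a fin_num by rewrite fin_num_measure.
rewrite sumEFin -EFinM sumr_const card_ord -(mulr_natl (fine _)) mulrA mulVf ?mul1r//.
Qed.

(** Almost everywhere convergence would make the lower limit at least 1/2 almost everywhere, while
    Fatou's lemma bounds its integral by [P E], the common integral of all the averages. *)
Lemma sweeping_not_cvg :
  (P E < 2^-1%:E)%E ->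
  (forall x j, exists n, (j <= n)%N /\ 2^-1 <= ergavg U a \1_E x n) ->
  ~ {ae P, forall x, cvgn (ergavg U a \1_E x)}.
Proof.
move=> PE sw cv.
have mg n : measurable_fun setT (fun x => (ergavg U a \1_E x n)%:E).
  exact/measurable_EFinP/measurable_ergavg_indic.
have g0 n x : (0 <= (ergavg U a \1_E x n)%:E)%E by rewrite lee_fin ergavg_indic_ge0.
have := @fatou _ _ _ P setT measurableT _ mg (fun n x _ => g0 n x).
rewrite (_ : (fun n => \int[P]_x (ergavg U a \1_E x n)%:E)%E = fun=> P E); last first.
  by apply/funext => n; exact: integral_ergavg_indic.
rewrite (cvg_limn_einf_sup (cvg_cst (P E))).1; apply/negP; rewrite -ltNge.
apply: (lt_le_trans PE).
have {1}-> : 2^-1%:E = (\int[P]_x (cst (2^-1 : R)%:E) x)%E.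
  by rewrite integral_cst// [X in (_ * X)%E]probability_setT mule1.
apply: ae_ge0_le_integral => //.
- by move=> x _; rewrite /= lee_fin invr_ge0.
- move=> x _; rewrite limn_einf_lim; apply: lime_ge; first exact: is_cvg_einfs.
  by apply: nearW => n; apply/ereal_infP => _ [m _ <-].
(* Measurability of the lower limit is obtained from that of the upper limit of the negated
   averages. *)
- rewrite (_ : (fun x => _) = (fun x =>
      - limn_esup (-%E \o (fun n => (ergavg U a \1_E x n)%:E)))%E).
    apply: measurableT_comp => //; apply: measurable_fun_limn_esup => n.
    exact: measurableT_comp.
  by apply/funext => x; rewrite limn_esupN oppeK.
apply: filterS cv => x cvx _ /=.
have cvE : (ergavg U a \1_E x n)%:E @[n --> \oo] --> (limn (ergavg U a \1_E x))%:E.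
  exact: cvg_EFin (nearW _ _) cvx.
rewrite (cvg_limn_einf_sup cvE).1 lee_fin leNgt; apply/negP => lt2.
have [N _ HN] : \forall n \near \oo, ergavg U a \1_E x n < 2^-1.
  exact: (cvgr_lt _ cvx).
have [n [Nn]] := sw x N.
by rewrite leNgt (HN n).
Qed.
End ErgodicAverages.

Lemma independent_not_pointwise_good (R : realType) (a : nat -> R) :
  (forall (K : nat) (q : nat -> int),
     \sum_(k < K) (q k)%:~R * a k = 0 -> forall k, (k < K)%N -> q k = 0) ->
  ~ pointwise_good a.
Proof.
move=> /exists_rotation_speed[l indep] good.
(* A set of radius [dl j] has measure at most [4 * dl j], so the total is at most 1/4. *)
pose dl j : R := 16^-1 / (2 ^ j.+1)%:R.
have dl0 j : 0 < dl j by rewrite divr_gt0// ltr0n expn_gt0.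
have dl1 j : dl j <= 1.
  have h : 1 <= (2 ^ j.+1)%:R :> R by rewrite ler1n expn_gt0.
  by rewrite ler_pdivrMr; lra.
have /choice[q qP] : forall j, exists q, (0 < q)%N /\ forall x, exists n, (j <= n)%N /\
    2^-1 <= n.+1%:R^-1 * \sum_(k < n.+1) \1_(near_int_set q (dl j)) (x + l * a k) :> R.
  by move=> j; exact: (@sweeping R (fun k => l * a k) indep (dl j) j (dl0 j)).
pose E : set (measurableTypeR R) := \bigcup_j near_int_set (q j) (dl j).
have mEj j : measurable (near_int_set (q j) (dl j) : set (measurableTypeR R)).
  by apply: measurable_near_int_set; case: (qP j).
have mE : measurable E by exact: bigcup_measurable.
have PE : (unit_prob E < 2^-1%:E)%E.
  apply: (@le_lt_trans _ _ (4^-1)%:E); last by rewrite lte_fin; lra.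
  apply: (@le_trans _ _ (\sum_(0 <= j <oo) unit_prob (near_int_set (q j) (dl j)))%E).
    exact: measure_sigma_subadditive.
  apply: le_trans (epsilon_trick0 xpredT (_ : 0 <= 4^-1 :> R)) => //.
  apply: lee_nneseries => // j _.
  apply: le_trans (unit_prob_near_int_set _ _) _; first by case: (qP j).
    by rewrite dl0 dl1.
  by rewrite lee_fin /dl mulrA; apply: ler_pM => //; lra.
apply: (sweeping_not_cvg (rotation_flow_mp l) mE PE (a := a)).
  (* The average over [E] dominates the one over its [j]-th piece, and that piece is invariant under
     the integer by which the flow differs from [x + l * a k]. *)
  move=> x j; have [q0 /(_ x)[n [jn Hn]]] := qP j; exists n; split => //.
  apply: le_trans Hn _; rewrite ler_pM2l ?invr_gt0//; apply: ler_sum => k _.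
  rewrite !indicE ler_nat; case: (boolP (_ \in near_int_set _ _)) => // /set_mem Hk.
  rewrite mem_set//; exists j => //; have [z ->] := rotation_flowE l (a k) x.
  exact/near_int_setD_int.
apply: good; first exact: rotation_flow_mp.
split; first exact: measurable_indic.
by exists 1; apply: nearW => x; rewrite indicE ger0_norm// lern1 leq_b1.
Qed.

(** * Zeros of analytic functions *)

Section Analytic.
Variable R : realType.
Implicit Types (f h : R -> R) (c : nat -> R).

Definition power_series_at (h : R -> R) (x0 : R) (c : nat -> R) (delta : R) :=
  forall x, 0 <= x -> `|x - x0| < delta ->
    (series (fun k => c k * (x - x0) ^+ k)) @ \oo --> h x.

Lemma power_series_coef_bound c (rho : R) : 0 < rho ->
  cvgn (series (fun k => c k * rho ^+ k)) ->
  exists M : R, 0 < M /\ forall k, `|c k| * rho ^+ k <= M.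
Proof.
move=> rho0 /cvg_series_cvg_0 c0.
have [M [Mr HM]] := cvg_seq_bounded (cvgP _ c0).
exists (`|M| + 1); split=> [|k]; first by rewrite ltr_wpDl.
rewrite -[rho ^+ k]gtr0_norm ?exprn_gt0// -normrM.
by apply: (HM (`|M| + 1) _ k) => //; rewrite (le_lt_trans (ler_norm M))// ltrDl.
Qed.

(** The terms after the leading one are compared with a geometric series of ratio at most 1/2; the
    bound is uniform in [n] and so passes to the limit. *)
Lemma power_series_tail_bound c (rho M y : R) (m n : nat) : 0 < rho -> 0 < M ->
  (forall k, `|c k| * rho ^+ k <= M) -> `|y| <= rho / 2 ->
  (forall k, (k < m)%N -> c k = 0) -> (m < n)%N ->
  `|series (fun k => c k * y ^+ k) n - c m * y ^+ m| <= 2 * M * (`|y| / rho) ^+ m.+1.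
Proof.
move=> rho0 M0 HM yrho cm mn.
pose t := `|y| / rho.
have t0 : 0 <= t by rewrite divr_ge0// ltW.
have t1 : t <= 2^-1 by rewrite ler_pdivrMr// mulrC.
(* Subtracting [t ^ n] makes the induction close: [M * t ^ n <= 2 * M * (t ^ n - t ^ n.+1)] for
   [t <= 1/2]. *)
suff : `|series (fun k => c k * y ^+ k) n - c m * y ^+ m| <= 2 * M * (t ^+ m.+1 - t ^+ n).
  move=> /le_trans; apply; rewrite ler_pM2l ?mulr_gt0//.
  by rewrite lerBlDr lerDl exprn_ge0.
elim: n mn => // n IH; rewrite ltnS leq_eqVlt => /predU1P[<-|mn].
  rewrite seriesEnat/= big_nat_recr//= big_nat_cond big1 ?add0r ?subrr ?mulr0 ?normr0//.
  by move=> k /andP[/andP[_ km] _]; rewrite cm// mul0r.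
rewrite seriesSr addrAC; apply: le_trans (ler_normD _ _) _.
apply: le_trans (lerD (IH mn) (_ : _ <= M * t ^+ n)) _; last first.
  have tn : 0 <= M * t ^+ n by rewrite mulr_ge0 ?exprn_ge0// ltW.
  rewrite (exprS t n); nra.
by rewrite normrM normrX /t expr_div_n mulrA ler_pdivlMr ?exprn_gt0// mulrAC ler_wpM2r ?exprn_ge0.
Qed.

(** Near [x0] the first nonzero term [c m * y ^+ m] exceeds the remainder, which has order
    [m.+1]. *)
Lemma power_series_isolated h x0 c delta : 0 <= x0 -> 0 < delta ->
  power_series_at h x0 c delta -> (exists k, c k != 0) ->
  exists2 e, 0 < e & forall x, 0 <= x -> 0 < `|x - x0| < e -> h x != 0.
Proof.
move=> x00 delta0 hc /cid[k0 k0P].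
have [m mP mmin] := ex_minnP (ex_intro (fun k => c k != 0) _ k0P).
have cm k : (k < m)%N -> c k = 0.
  by move=> km; apply/eqP; apply: contraTT km => /mmin; rewrite -leqNgt.
pose rho := delta / 2.
have rho0 : 0 < rho by rewrite divr_gt0.
have [|M [M0 HM]] := @power_series_coef_bound c rho rho0.
  have := hc (x0 + rho); rewrite [x0 + rho]addrC addrK => /(_ _ _)/cvgP; apply.
    by rewrite addr_ge0// ltW.
  by rewrite gtr0_norm// /rho; lra.
have cm0 : 0 < `|c m| by rewrite normr_gt0.
(* The first bound allows the tail estimate; the second makes [2 * M * (|y| / rho) ^+ m.+1] smaller
   than [|c m| * |y| ^+ m]. *)
pose e := Num.min (rho / 2) (`|c m| * rho ^+ m.+1 / (2 * M)).
exists e; first by rewrite lt_min !(divr_gt0, mulr_gt0, exprn_gt0).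
move=> x x_ge0 /andP[y0]; rewrite lt_min; set y := x - x0 in y0 *.
move=> /andP[y1]; rewrite ltr_pdivlMr ?mulr_gt0// => y2.
have cx : series (fun k => c k * y ^+ k) @ \oo --> h x.
  by apply: hc => //; rewrite -/y (lt_trans y1)// /rho; lra.
have tail n := @power_series_tail_bound c rho M y m n rho0 M0 HM (ltW y1) cm.
have lim_tail : `|h x - c m * y ^+ m| <= 2 * M * (`|y| / rho) ^+ m.+1.
  have ct : `|series (fun k => c k * y ^+ k) n - c m * y ^+ m| @[n --> \oo]
      --> `|h x - c m * y ^+ m|.
    by apply: cvg_norm; apply: cvgB => //; exact: cvg_cst.
  rewrite -(cvg_lim _ ct)//; apply: limr_le; first by apply/cvg_ex; eexists; exact: ct.
  by exists m.+1 => // n /= mn; exact: tail.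
apply/eqP => hx0; move: lim_tail; rewrite hx0 sub0r normrN normrM normrX.
apply/negP; rewrite -ltNge expr_div_n mulrA ltr_pdivrMr ?exprn_gt0//.
rewrite exprS mulrA [ltRHS]mulrAC ltr_pM2r ?exprn_gt0//.
by rewrite mulrC.
Qed.

Lemma power_series_zero h x0 delta : 0 <= x0 -> power_series_at h x0 (fun=> 0) delta ->
  forall x, 0 <= x -> `|x - x0| < delta -> h x = 0.
Proof.
move=> x00 hc x x_ge0 xd; have := hc x x_ge0 xd.
rewrite (_ : series _ = fun=> 0); last first.
  by apply/funext => n; rewrite seriesEnat/= big1// => k _; rewrite mul0r.
by move/(cvg_lim (@Rhausdorff _)) => <-; rewrite lim_cst.
Qed.

Definition locally_zero h x0 := exists2 e, 0 < e & forall x, 0 <= x -> `|x - x0| < e -> h x = 0.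

Definition isolated_zero h x0 :=
  exists2 e, 0 < e & forall x, 0 <= x -> 0 < `|x - x0| < e -> h x != 0.

Lemma analytic_dichotomy h x0 : analytic_on_nonneg h -> 0 <= x0 ->
  locally_zero h x0 \/ isolated_zero h x0.
Proof.
move=> ha x00; have [c [delta [delta0 hc]]] := ha _ x00.
have [c0|c0] := pselect (exists k, c k != 0).
  by right; exact: power_series_isolated x00 delta0 hc c0.
left; exists delta => //; apply: (power_series_zero x00).
suff <- : c = fun=> 0 by [].
apply/funext => k; apply/eqP; apply: contrapT => ck; apply: c0; exists k; exact/negP.
Qed.

Lemma locally_zero_not_isolated h x0 : 0 <= x0 -> locally_zero h x0 -> ~ isolated_zero h x0.
Proof.
move=> x00 [e e0 He] [e' e'0 He'].
pose t := Num.min e e' / 2.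
have m0 : 0 < Num.min e e' by rewrite lt_min e0.
have t0 : 0 < t by rewrite divr_gt0.
have tm : t < Num.min e e' by rewrite /t; lra.
have tE : `|x0 + t - x0| = t by rewrite addrC addKr gtr0_norm.
have x0t : 0 <= x0 + t by rewrite addr_ge0// ltW.
move: tm; rewrite lt_min => /andP[te te'].
by have := He' _ x0t; rewrite tE t0 te' => /(_ isT); rewrite He ?tE ?eqxx.
Qed.

(** Being locally zero and being isolated are both open conditions, and on [[0, +oo[] exactly one of
    them holds at each point; connectedness concludes. *)
Lemma analytic_identity h x0 : analytic_on_nonneg h -> 0 <= x0 -> locally_zero h x0 ->
  forall x, 0 <= x -> h x = 0.
Proof.
move=> ha x00 hx0 x x_ge0.
pose A : set R := `[0, +oo[%classic.
pose S : set R := A `&` [set x | locally_zero h x].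
have op : open [set x | locally_zero h x].
  rewrite openE => y [e e0 He]; rewrite /interior; apply/nbhs_ballP.
  exists (e / 2) => /=; first by rewrite divr_gt0.
  move=> z; rewrite -ball_normE/= => yz; exists (e / 2); first by rewrite divr_gt0.
  move=> w w0 wz; apply: He => //; rewrite (splitr e).
  by rewrite -(subrK z w) -addrA (le_lt_trans (ler_normD _ _))// ltrD// distrC.
have oq : open [set x | isolated_zero h x].
  rewrite openE => y [e e0 He]; rewrite /interior; apply/nbhs_ballP.
  exists e => //= z; rewrite -ball_normE/= => yz.
  have [->|zy] := eqVneq z y; first by exists e.
  (* This radius around [z] excludes [y] and stays within distance [e] of [y]. *)
  pose g := Num.min `|z - y| (e - `|z - y|).
  exists g; first by rewrite lt_min normr_gt0 subr_eq0 zy subr_gt0 distrC.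
  move=> w w0 /andP[_]; rewrite lt_min => /andP[wz1 wz2]; apply: He => //.
  rewrite normr_gt0 subr_eq0; apply/andP; split.
    by apply: contraTneq wz1 => ->; rewrite distrC ltxx.
  by rewrite -(subrK z w) -addrA (le_lt_trans (ler_normD _ _))// -ltrBrDr.
have cA : connected A by apply/connected_intervalP; exact: interval_is_interval.
have SA : S = A.
  apply: cA.
  - by exists x0; split => //; rewrite /A/= in_itv/= x00.
  - by exists [set x | locally_zero h x].
  - exists (~` [set x | isolated_zero h x]); first exact: open_closedC.
    apply/seteqP; split => y [Ay hy]; split => //.
      by apply: locally_zero_not_isolated => //; move: Ay; rewrite /A/= in_itv/= andbT.
    by move: Ay; rewrite /A/= in_itv/= andbT => /(analytic_dichotomy ha)[].
have : S x by rewrite SA /A/= in_itv/= x_ge0.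
by move=> [_ [e e0]]; apply; rewrite ?subrr ?normr0.
Qed.

(** Each zero is the only zero in some interval with rational endpoints, and there are countably
    many such intervals. *)
Lemma isolated_zeros_countable h :
  (forall x, 0 <= x -> isolated_zero h x) -> countable [set x | 0 <= x /\ h x = 0].
Proof.
move=> iso.
pose B (pq : rat * rat) := [set x | 0 <= x /\ h x = 0 /\ ratr pq.1 < x < ratr pq.2 /\
   forall y, 0 <= y -> h y = 0 -> ratr pq.1 < y < ratr pq.2 -> y = x].
apply: (@sub_countable _ _ _ (\bigcup_pq B pq)); last first.
  apply: bigcup_countable => // pq _; apply/countable_injP; exists (fun=> 0%N).
  move=> x y /set_mem[x0 [hx [xpq _]]] /set_mem[y0 [hy [ypq uy]]] _.
  exact: uy.
apply: subset_card_le => x [x0 hx].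
have [e e0 He] := iso x x0.
have /rat_in_itvoo[p] : x - e < x by lra.
have /rat_in_itvoo[q] : x < x + e by lra.
rewrite !in_itv/= => /andP[q1 q2] /andP[p1 p2]; exists (p, q) => //.
split=> //; split => //; split; first by rewrite p2 q1.
move=> y y0 hy /=/andP[y1 y2]; apply/eqP; apply: contrapT => /negP yx.
have yxe : 0 < `|y - x| < e.
  by rewrite normr_gt0 subr_eq0 yx ltr_norml; apply/andP; split; lra.
by have := He y y0 yxe; rewrite hy eqxx.
Qed.

Lemma analytic_uncountable_zeros h : analytic_on_nonneg h ->
  ~ countable [set x | 0 <= x /\ h x = 0] -> locally_zero h 0.
Proof.
move=> ha unc; apply: contrapT => nlz; apply: unc; apply: isolated_zeros_countable => x x0.
case: (analytic_dichotomy ha x0) => // hx.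
case: nlz; exists 1 => // y y0 _; exact: analytic_identity hx y y0.
Qed.

End Analytic.

(** * Linear relations between dilates *)

Section Dilates.
Variable R : realType.

Lemma power_series_at_polyC (p : {poly R}) (x0 : R) :
  power_series_at (fun x => p.[x]) x0 (fun k => p^`N(k).[x0]) 1.
Proof.
move=> x _ _; apply: cvg_near_cst; exists (size p) => // n /= pn.
rewrite -[in RHS](addrNK x0 x) [in RHS]addrC.
by rewrite (nderiv_taylor_wide (mulrC x0 (x - x0)) pn) seriesEord.
Qed.

Lemma analytic_sub_poly (f : R -> R) (p : {poly R}) : analytic_on_nonneg f ->
  analytic_on_nonneg (fun x => f x - p.[x]).
Proof.
move=> fa x0 x00; have [c [d [d0 fc]]] := fa _ x00.
exists (fun k => c k - p^`N(k).[x0]), (Num.min d 1); split; first by rewrite lt_min d0/=.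
move=> x x_ge0; rewrite lt_min => /andP[xd x1].
rewrite (_ : series _ = series (fun k => c k * (x - x0) ^+ k) -
    series (fun k => p^`N(k).[x0] * (x - x0) ^+ k)).
  exact: cvgB (fc x x_ge0 xd) (power_series_at_polyC x_ge0 x1).
apply/funext => n; rewrite fctE !seriesEnat/= -sumrB.
by apply: eq_bigr => k _; rewrite mulrBl.
Qed.

Lemma power_series_dilate (f : R -> R) (c : nat -> R) (x0 s d : R) : 0 < s ->
  power_series_at f (s * x0) c d ->
  power_series_at (fun x => f (s * x)) x0 (fun k => c k * s ^+ k) (d / s).
Proof.
move=> s0 fc x x_ge0; rewrite ltr_pdivlMr// => xd.
rewrite (_ : (fun k => _) = fun k => c k * (s * x - s * x0) ^+ k).
  by apply: fc; rewrite ?mulr_ge0 ?(ltW s0)// -mulrBr normrM (gtr0_norm s0) mulrC.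
by apply/funext => k; rewrite -mulrBr exprMn mulrA.
Qed.

(** The coefficients depend on [k] because [f] is expanded at the different points [r k * x0]; at
    [x0 = 0] one expansion serves all [k]. *)
Lemma power_series_dilates (f : R -> R) (r : nat -> R) (q : nat -> R)
    (c : nat -> nat -> R) (d : nat -> R) (x0 : R) (K : nat) :
  (forall k, 0 < r k) -> (forall k, 0 < d k) ->
  (forall k, power_series_at f (r k * x0) (c k) (d k)) ->
  exists2 e, 0 < e & power_series_at (fun x => \sum_(k < K) q k * f (r k * x)) x0
     (fun n => \sum_(k < K) q k * (c k n * r k ^+ n)) e.
Proof.
move=> r0 d0 fc; elim: K => [|K [e e0 IH]].
  exists 1 => // x _ _; rewrite big_ord0 (_ : series _ = fun=> 0); first exact: cvg_cst.
  by apply/funext => n; rewrite seriesEnat/= big1// => k _; rewrite big_ord0 mul0r.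
exists (Num.min e (d K / r K)); first by rewrite lt_min e0 divr_gt0.
move=> x x_ge0; rewrite lt_min => /andP[xe xd]; rewrite big_ord_recr/=.
rewrite (_ : series _ = fun n => series (fun k => (\sum_(i < K) q i * (c i k * r i ^+ k)) *
    (x - x0) ^+ k) n + q K * series (fun k => c K k * r K ^+ k * (x - x0) ^+ k) n).
  apply: cvgD; first exact: IH.
  by apply: cvgMr; exact: power_series_dilate (fc K) _ _ _.
apply/funext => n; rewrite !seriesEnat/= mulr_sumr -big_split/=.
by apply: eq_bigr => k _; rewrite big_ord_recr/= mulrDl !mulrA.
Qed.

(** Divide by [r i ^+ n], where [r i] is the largest with [q i != 0]. As the [r k] are distinct, the
    other terms tend to 0 and the quotient tends to [q i]. *)
Lemma dominant_power_sum (r q : nat -> R) (K : nat) : injective r -> (forall k, 0 < r k) ->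
  (exists2 k, (k < K)%N & q k != 0) ->
  exists N, forall n, (N <= n)%N -> \sum_(k < K) q k * r k ^+ n != 0.
Proof.
move=> rinj r0 [k0 k0K qk0].
have [i qi imax] := arg_maxP (i0 := Ordinal k0K) (P := fun k : 'I_K => q k != 0)
  (fun k : 'I_K => r k) qk0.
have cv : \sum_(k < K) q k * (r k / r i) ^+ n @[n --> \oo] --> q i.
  have -> : q i = \sum_(k < K) (if k == i then q i else 0) by rewrite -big_mkcond/= big_pred1_eq.
  apply: cvg_big => [|k _]; first exact: add_continuous.
  case: eqVneq => [->|ki].
    apply: cvg_near_cst; apply: nearW => n.
    by rewrite divff ?expr1n ?mulr1// gt_eqF.
  have [->|qk] := eqVneq (q k) 0; first by under eq_fun do rewrite mul0r; exact: cvg_cst.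
  rewrite -[0](mulr0 (q k)); apply: cvgMr; apply: cvg_expr.
  rewrite ger0_norm ?divr_ge0 ?(ltW (r0 _))// ltr_pdivrMr// mul1r lt_neqAle.
  apply/andP; split; last exact: imax.
  by apply: contra_neq ki => /rinj /val_inj.
have [N _ HN] : \forall n \near \oo, \sum_(k < K) q k * (r k / r i) ^+ n != 0.
  exact: cvgr_neq0 cv qi.
exists N => n Nn; apply: contraNneq (HN n Nn) => S0.
have -> : \sum_(k < K) q k * (r k / r i) ^+ n = (\sum_(k < K) q k * r k ^+ n) / r i ^+ n.
  by rewrite mulr_suml; apply: eq_bigr => k _; rewrite expr_div_n mulrA.
by rewrite S0 mul0r.
Qed.

Lemma dilates_relation_poly (f : R -> R) (r q : nat -> R) (K : nat) :
  injective r -> (forall k, 0 < r k) -> analytic_on_nonneg f ->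
  (exists2 k, (k < K)%N & q k != 0) ->
  ~ countable [set u | 0 <= u /\ \sum_(k < K) q k * f (r k * u) = 0] ->
  exists p : {poly R}, forall x, 0 <= x -> f x = p.[x].
Proof.
move=> rinj r0 fa qn0 unc.
pose g x := \sum_(k < K) q k * f (r k * x).
have ga : analytic_on_nonneg g.
  move=> x0 x00.
  have /choice[c] : forall k, exists c, exists delta : R, 0 < delta /\
      power_series_at f (r k * x0) c delta.
    by move=> k; apply: fa; rewrite mulr_ge0// ltW.
  move=> /choice[d cd].
  have [//|k|k|e e0 ge] := @power_series_dilates f r q c d x0 K.
  - by case: (cd k).
  - by case: (cd k).
  - by exists (fun n => \sum_(k < K) q k * (c k n * r k ^+ n)), e.
have [c [d [d0 fc]]] := fa 0 (lexx 0).
have [//|//|k|e e0 gc] := @power_series_dilates f r q (fun=> c) (fun=> d) 0 K.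
  by rewrite mulr0.
have g0 : locally_zero g 0 by exact: analytic_uncountable_zeros.
have cn n : c n * \sum_(k < K) q k * r k ^+ n = 0.
  have -> : c n * \sum_(k < K) q k * r k ^+ n = \sum_(k < K) q k * (c n * r k ^+ n).
    by rewrite mulr_sumr; apply: eq_bigr => k _; rewrite mulrCA.
  apply/eqP; apply: contrapT => /negP cn0.
  apply: (locally_zero_not_isolated (lexx 0) g0).
  by apply: (power_series_isolated (lexx 0) e0 gc); exists n.
have [N HN] := dominant_power_sum rinj r0 qn0.
(* The [c n] with [n >= N] vanish, so [f] equals [p] near 0; the identity theorem for [f - p]
   extends this to the half-line. *)
pose p := \poly_(i < N) c i.
exists p => x x_ge0; apply/eqP; rewrite -subr_eq0; apply/eqP.
apply: (analytic_identity (analytic_sub_poly p fa) (lexx 0) _ x_ge0).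
exists d => // y y0 yd; apply/eqP; rewrite subr_eq0; apply/eqP.
apply: (cvg_unique (@Rhausdorff R) (fc y y0 yd)).
apply: cvg_near_cst; exists N => // n /= Nn.
rewrite seriesEnat/= (big_cat_nat (n := N))//= [X in _ + X]big_nat_cond [X in _ + X]big1 ?addr0.
  by rewrite horner_poly big_mkord; apply: eq_bigr => k _; rewrite subr0.
move=> k /andP[/andP[Nk _] _]; have /eqP := cn k.
by rewrite mulf_eq0 (negbTE (HN k Nk)) orbF => /eqP ->; rewrite mul0r.
Qed.

End Dilates.

Theorem theorem1 (R : realType) (r : nat -> R) (f : R -> R) :
  injective r -> (forall k, 0 < r k) ->
  analytic_on_nonneg f ->
  ~ countable [set u : R | 0 < u /\ pointwise_good (fun k => f (r k * u))] ->
  exists p : {poly R}, forall x, 0 <= x -> f x = p.[x].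
Proof.
move=> rinj r0 fa unc; apply: contrapT => npoly; apply: unc.
(* Integer relations are coded by finite sequences, a countable type, so it suffices that each [Z s]
   is countable. *)
pose Z (s : seq int) := [set u : R | (exists2 k, (k < size s)%N & s`_k != 0) /\
  0 <= u /\ \sum_(k < size s) (s`_k)%:~R * f (r k * u) = 0].
apply: (@sub_countable _ _ _ (\bigcup_s Z s)); last first.
  apply: bigcup_countable => // s _.
  have [sn0|sn0] := pselect (exists2 k, (k < size s)%N & s`_k != 0); last first.
    by rewrite (_ : Z s = set0) ?countable0//; apply/seteqP; split => // u [].
  apply: contrapT => unc; apply: npoly.
  apply: (@dilates_relation_poly _ f r (fun k => (s`_k)%:~R) (size s)) => //.
    by case: sn0 => k ks sk; exists k => //; rewrite intr_eq0.
  by apply: contra_not unc; apply: sub_countable; apply: subset_card_le => u [].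
(* For [u] outside every [Z s] the numbers [f (r k * u)] satisfy no nontrivial relation, contrary to
   [good]. *)
apply: subset_card_le => u [u0 good]; apply: contrapT => nZ.
apply: (independent_not_pointwise_good _ good) => K q qE k kK.
apply/eqP; apply: contrapT => /negP qk; apply: nZ.
exists (mkseq q K) => //; rewrite /Z/= size_mkseq; split; first by exists k; rewrite ?nth_mkseq.
split; first exact: ltW.
by rewrite -[RHS]qE; apply: eq_bigr => i _; rewrite nth_mkseq.
Qed.
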